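(* Let $y_1(x)={}_2F_1(a,b;c;x)$, let $\omega(x)=x^{c-1}(1-x)^{a+b-c}$, and let $\rho(x)=|y_1(x)|^2\omega(x)$. Let $f$ be a continuous function and let $\lambda_1=\int_0^1\rho(x)f(x)\,dx$. Assume that $\langle f,f\rangle_\omega=1$. Then $$\lambda_1\le\left(\int_0^1\frac{\rho(x)^2}{\omega(x)}\,dx\right)^{1/2},$$ with equality if and only if $f(x)=C|y_1(x)|^2$ for some constant $C$.
   Context: $a,b,c$ are (generic complex) parameters of the hypergeometric equation $x(1-x)y''+[c-(a+b+1)x]y'-ab\,y=0$, and ${}_2F_1(a,b;c;x)$ is the hypergeometric series solving it. The inner product is $\langle g,h\rangle_\omega=\int_0^1g(x)\overline{h(x)}\,\omega(x)\,dx$. The number $\lambda_1$ arises as the first-order coefficient in the expansion $ab+\lambda_1\varepsilon+\mathcal{O}(\varepsilon^2)$ of the eigenvalue of $\widetilde L+\varepsilon f(x)$, where $\widetilde L=x(1-x)\frac{d^2}{dx^2}+[c-(a+b+1)x]\frac{d}{dx}$, for an eigenfunction of the form $y_1+\mathcal{O}(\varepsilon)$; it is viewed as the linear functional of $f$ given by integration against the density function $\rho(x)$.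
   Formalization: The constant C in the equality case is required to be a positive real (for negative C, e.g. f=-1 with y_1=ω=1, equality fails); ω is assumed positive on (0,1), λ_1 real, and c not a non-positive integer, so that the inner product, the inequality and y_1 make sense. *)

(* Defs.v *)
From HB Require Import structures.
From mathcomp Require Import all_boot all_order all_algebra.
From mathcomp Require Import all_classical all_reals all_analysis.
From mathcomp Require Import complex.

Set Implicit Arguments.
Unset Strict Implicit.
Unset Printing Implicit Defensive.

Import Order.TTheory GRing.Theory Num.Theory.
Import numFieldNormedType.Exports.

Local Open Scope classical_set_scope.
Local Open Scope ring_scope.
Local Open Scope complex_scope.

Section Hypergeometric.
Variable R : realType.
Implicit Types (a b c s : R[i]) (x : R).

Definition pochhammer s (n : nat) : R[i] := \prod_(k < n) (s + k%:R).

Definition hyp2F1_term a b c x (n : nat) : R[i] :=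
  pochhammer a n * pochhammer b n / (pochhammer c n * n`!%:R) * x%:C ^+ n.

(* The limit is taken in the norm topology of the field R[i]. *)
Definition hyp2F1 a b c x : R[i] :=
  limn (series (hyp2F1_term a b c x : nat -> R[i]^o)).

(* Principal value of x^s = exp (s ln x); meaningful for 0 < x. *)
Definition cpow x s : R[i] :=
  (x `^ complex.Re s)%:C *
  (cos (complex.Im s * ln x) +i* sin (complex.Im s * ln x)).

Definition omega a b c x : R[i] :=
  cpow x (c - 1) * cpow (1 - x) (a + b - c).

Definition rho a b c x : R[i] := `|hyp2F1 a b c x| ^+ 2 * omega a b c x.

(* Lebesgue integral over (0, 1) of a complex-valued function; like Rintegral it
   is total, with a meaningless value when h is not integrable. *)
Definition cint01 (h : R -> R[i]) : R[i] :=
  (\int[lebesgue_measure]_(x in `]0%R, 1%R[) complex.Re (h x)) +i*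
  (\int[lebesgue_measure]_(x in `]0%R, 1%R[) complex.Im (h x)).

Definition inner (w : R -> R[i]) (g h : R -> R[i]) : R[i] :=
  cint01 (fun x => g x * (h x)^* * w x).

End Hypergeometric.

(* Main.v *)
Require Import Defs.
From HB Require Import structures.
From mathcomp Require Import all_boot all_order all_algebra.
From mathcomp Require Import all_classical all_reals all_analysis.
From mathcomp Require Import complex.
From mathcomp Require Import measurable_realfun ring lra.

Set Implicit Arguments.
Unset Strict Implicit.
Unset Printing Implicit Defensive.

Import Order.TTheory GRing.Theory Num.Theory.
Import numFieldNormedType.Exports.
Import Normc.

Local Open Scope classical_set_scope.
Local Open Scope ring_scope.
Local Open Scope complex_scope.

(** Write [Y = |y_1|^2], [W = omega] and [B = \int Y^2 W = \int rho^2 / omega].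
    If [0 < B < +oo] and [t = 1 / sqrt B], then expanding the square gives
    [0 <= \int |f - t Y|^2 W = 2 (1 - lambda_1 / sqrt B)], which is the bound, with
    equality iff [f = t Y] almost everywhere, hence everywhere on (0, 1) because both
    sides are continuous. The continuity of [Y] on the whole interval (-1, 1) comes
    from the growth of the coefficients of the series; together with [y_1(0) = 1] it
    also rules out [B = 0]. When [B = +oo], the bound is strict and [f = C Y] is
    incompatible with the normalization. *)

(** * Real power series with coefficients of subexponential growth *)

Lemma ratio_eventually_le (R : realType) (s p q : R) : 1 < s ->
  exists N : nat, forall n, (N <= n)%N -> p + n%:R <= s * (n%:R - q).
Proof.
(* The threshold comes from solving the inequality for [n], where [s - 1] is positive. *)
move=> s1; exists (Num.bound `|(p + s * q) / (s - 1)|) => n Nn.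
have s10 : 0 < s - 1 by rewrite subr_gt0.
have : (p + s * q) / (s - 1) <= n%:R.
  rewrite (le_trans (ler_norm _))// (le_trans (ltW (archi_boundP _)))//.
  by rewrite ler_nat.
rewrite ler_pdivrMr//; lra.
Qed.

Section SubexponentialCoefficients.
Variable R : realType.
Implicit Types (f : R^nat) (x s : R).

(* Equivalently, the radius of convergence of [pseries f] is at least 1. *)
Definition subexponential f :=
  forall s, 1 < s -> exists M, forall n, `|f n| <= M * s ^+ n.

Lemma subexponential_ratio f :
  (forall s, 1 < s -> exists N, forall n, (N <= n)%N -> `|f n.+1| <= s * `|f n|) ->
  subexponential f.
Proof.
move=> rf s s1; have [N fN] := rf s s1.
(* This sum dominates every term of index at most [N]; beyond [N] the ratio bound carries the
   induction. *)
exists (\sum_(i < N.+1) `|f i|); elim=> [|n IHn].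
  by rewrite expr0 mulr1 big_ord_recl lerDl sumr_ge0.
have [nN|Nn] := ltnP n N.
  rewrite (@le_trans _ _ (\sum_(i < N.+1) `|f i|))//.
    have iN : (n.+1 < N.+1)%N by [].
    by rewrite (bigD1 (Ordinal iN))//= lerDl sumr_ge0.
  by rewrite ler_peMr ?sumr_ge0// exprn_ege1// ltW.
rewrite (le_trans (fN _ Nn))// exprS mulrCA ler_wpM2l// (le_trans _ (ltW s1))//.
Qed.

(** With [s = t ^+ 2], one factor [t ^+ n] absorbs [n.+1] and the other absorbs the coefficient; the
    shift of index costs one constant factor [t]. *)
Lemma subexponential_diffs f : subexponential f -> subexponential (pseries_diffs f).
Proof.
move=> sf s s1.
have t1 : 1 < Num.sqrt s by rewrite -sqrtr1 ltr_sqrt// (lt_trans _ s1).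
have st : s = Num.sqrt s ^+ 2 by rewrite sqr_sqrtr// ltW// (lt_trans _ s1).
set t := Num.sqrt s in t1 st.
have [M fM] := sf t t1.
have [L Ln] : exists L, forall n, `|n.+1%:R| <= L * t ^+ n.
  apply: (@subexponential_ratio (fun n => n.+1%:R)) => // u u1.
  (* The choice [2], [-1] yields [2 + n <= u * (n + 1)], the ratio bound for [n.+1]. *)
  have [N Nn] := ratio_eventually_le 2 (-1) u1; exists N => n /Nn.
  by rewrite !normr_nat -!nat1r; lra.
exists (L * (M * t)) => n; rewrite /pseries_diffs normrM.
rewrite (le_trans (ler_pM _ _ (Ln n) (fM n.+1)))//.
rewrite st -/t -exprM mulnC exprM exprS.
by rewrite [leRHS](_ : _ = L * t ^+ n * (M * (t * t ^+ n)))//; ring.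
Qed.

Lemma is_cvg_subexponential f x : subexponential f -> `|x| < 1 ->
  cvgn (pseries f x).
Proof.
(* This [s] satisfies both [1 < s] and [s * |x| < 1], so a geometric series of ratio [s * |x|]
   dominates. *)
move=> sf x1; pose s := 2 / (1 + `|x|).
have d0 : 0 < 1 + `|x| by rewrite ltr_wpDr.
have s1 : 1 < s by rewrite ltr_pdivlMr// mul1r; lra.
have sx1 : s * `|x| < 1 by rewrite mulrAC ltr_pdivrMr// mul1r; lra.
have [M fM] := sf s s1.
have M0 : 0 <= M by have := fM 0; rewrite expr0 mulr1; apply: le_trans.
apply: normed_cvg.
apply: (@series_le_cvg _ _ (geometric M (s * `|x|))) => [n|n|n|] /=.
- by [].
- by rewrite mulr_ge0// exprn_ge0// mulr_ge0// (le_trans _ (ltW s1)).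
- by rewrite normrM normrX exprMn mulrA ler_wpM2r.
- apply: is_cvg_geometric_series; rewrite ger0_norm//.
  by rewrite mulr_ge0// (le_trans _ (ltW s1)).
Qed.

(** Termwise differentiation at [x] asks for convergence of the series and of its first two derived
    series at a point of larger modulus; the midpoint [K] of [|x|] and 1 serves. *)
Lemma continuous_subexponential f x : subexponential f -> `|x| < 1 ->
  {for x, continuous (fun y => limn (pseries f y))}.
Proof.
move=> sf x1; pose K := (1 + `|x|) / 2.
have K0 : 0 <= K by rewrite divr_ge0// addr_ge0.
have K1 : `|K| < 1 by rewrite ger0_norm// ltr_pdivrMr//; lra.
have xK : `|x| < `|K| by rewrite (ger0_norm K0) ltr_pdivlMr//; lra.
have sdf := subexponential_diffs sf; have sddf := subexponential_diffs sdf.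
have [dx _] := pseries_snd_diffs (is_cvg_subexponential sf K1)
  (is_cvg_subexponential sdf K1) (is_cvg_subexponential sddf K1) xK.
exact/differentiable_continuous/derivable1_diffP.
Qed.

End SubexponentialCoefficients.

(** * Componentwise convergence in [R[i]] *)

Section ComplexTopology.
Variable R : realType.
Implicit Types (z : R[i]).

Lemma normc_ge_Re z : `|complex.Re z| <= normc z.
Proof. by case: z => x y /=; rewrite -sqrtr_sqr ler_wsqrtr// lerDl sqr_ge0. Qed.

Lemma normc_ge_Im z : `|complex.Im z| <= normc z.
Proof. by case: z => x y /=; rewrite -sqrtr_sqr ler_wsqrtr// lerDr sqr_ge0. Qed.

Lemma normc_ReIm z : normc z <= `|complex.Re z| + `|complex.Im z|.
Proof.
case: z => x y /=; rewrite -[leRHS]ger0_norm ?addr_ge0// -sqrtr_sqr ler_wsqrtr//.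
rewrite sqrrD !real_normK ?num_real// -addrA [_ *+ 2 + _]addrC addrA.
by rewrite lerDl mulrn_wge0// mulr_ge0.
Qed.

Lemma norm_normc z : `|z| = (normc z)%:C.
Proof. by case: z. Qed.

Lemma cvg_complexP (T : Type) (F : set_system T) (FF : Filter F)
    (g : T -> R[i]^o) (l : R[i]^o) :
  g @ F --> l <->
  (fun t => complex.Re (g t)) @ F --> complex.Re l /\
  (fun t => complex.Im (g t)) @ F --> complex.Im l.
Proof.
have subRe (u v : R[i]) : complex.Re u - complex.Re v = complex.Re (u - v).
  by case: u v => [? ?] [? ?].
have subIm (u v : R[i]) : complex.Im u - complex.Im v = complex.Im (u - v).
  by case: u v => [? ?] [? ?].
split=> [gl|[gRe gIm]].
  split; apply/cvgrPdist_lt => e e0.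
    have /cvgrPdist_lt /(_ e%:C) := gl; rewrite ltcR => /(_ e0).
    apply: filterS => t; rewrite norm_normc ltcR; apply: le_lt_trans.
    by rewrite subRe normc_ge_Re.
  have /cvgrPdist_lt /(_ e%:C) := gl; rewrite ltcR => /(_ e0).
  apply: filterS => t; rewrite norm_normc ltcR; apply: le_lt_trans.
  by rewrite subIm normc_ge_Im.
(* In the order of [R[i]], a positive radius has zero imaginary part. *)
apply/cvgrPdist_lt => -[e ei]; rewrite ltcE => /andP[/= /eqP -> e0].
have e20 : 0 < e / 2 by rewrite divr_gt0.
have /cvgrPdist_lt /(_ _ e20) gRe2 := gRe.
have /cvgrPdist_lt /(_ _ e20) gIm2 := gIm.
apply: filterS2 gRe2 gIm2 => t tRe tIm.
rewrite norm_normc (ltcR _ e) (le_lt_trans (normc_ReIm _))// -subRe -subIm.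
by rewrite [ltRHS]splitr ltrD.
Qed.

End ComplexTopology.

(** * The hypergeometric series on (-1, 1) *)

Section HypergeometricSeries.
Variables (R : realType) (a b c : R[i]).
Hypothesis c_generic : forall n : nat, c != - n%:R.

Definition hyp2F1_coef n : R[i] :=
  pochhammer a n * pochhammer b n / (pochhammer c n * n`!%:R).

Lemma hyp2F1_termE x n : hyp2F1_term a b c x n = hyp2F1_coef n * (x ^+ n)%:C.
Proof. by rewrite rmorphXn. Qed.

Lemma hyp2F1_coefS n : hyp2F1_coef n.+1 =
  (a + n%:R) * (b + n%:R) / ((c + n%:R) * n.+1%:R) * hyp2F1_coef n.
Proof.
rewrite /hyp2F1_coef /pochhammer !big_ord_recr/= factS natrM.
rewrite -!/(pochhammer _ _) !invfM; ring.
Qed.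

Lemma normc_nat n : normc (n%:R : R[i]) = n%:R.
Proof. by rewrite normcMn normc1. Qed.

(** The quotient of consecutive coefficients in [hyp2F1_coefS] tends to 1, hence its modulus is
    eventually below any [s > 1]; [c_generic] keeps [c + n] away from 0. *)
Lemma subexponential_normc_hyp2F1_coef :
  subexponential (fun n => normc (hyp2F1_coef n)).
Proof.
apply: subexponential_ratio => s s1.
have t1 : 1 < Num.sqrt s by rewrite -sqrtr1 ltr_sqrt// (lt_trans _ s1).
have st : s = Num.sqrt s ^+ 2 by rewrite sqr_sqrtr// ltW// (lt_trans _ s1).
move: t1 st; set t := Num.sqrt s => t1 st.
(* Half of the growth rate [s = t * t] is spent on [a + n] over [c + n],
   half on [b + n] over [n + 1]. *)
have [N1 aN] := ratio_eventually_le (normc a) (normc c) t1.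
have [N2 bN] := ratio_eventually_le (normc b) (-1) t1.
exists (N1 + N2)%N => n Nn.
have {}aN := aN _ (leq_trans (leq_addr _ _) Nn).
have {}bN := bN _ (leq_trans (leq_addl _ _) Nn).
have nge0 (z : R[i]) : 0 <= normc z by case: z => x y; exact: sqrtr_ge0.
have normD (z : R[i]) : normc (z + n%:R) <= normc z + n%:R.
  by rewrite (le_trans (le_normcD _ _))// normc_nat.
have normB : n%:R - normc c <= normc (c + n%:R).
  rewrite lerBlDr -normc_nat -(normcN c).
  by rewrite (le_trans _ (le_normcD _ _))// addrAC subrr add0r.
have c0 : 0 < normc (c + n%:R).
  rewrite lt_neqAle nge0 andbT eq_sym.
  by apply: contra (c_generic n) => /eqP/eq0_normc/eqP; rewrite addr_eq0.
rewrite !ger0_norm// hyp2F1_coefS normcM ler_wpM2r// !(normcM, normcV) normc_nat.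
rewrite ler_pdivrMr ?mulr_gt0// st expr2 mulrACA ler_pM//.
  by rewrite (le_trans (normD _))// (le_trans aN)// ler_wpM2l// (le_trans _ (ltW t1)).
rewrite (le_trans (normD _))// (le_trans bN)//.
by rewrite -natr1 opprK.
Qed.

Lemma subexponential_Re_hyp2F1_coef :
  subexponential (fun n => complex.Re (hyp2F1_coef n)).
Proof.
move=> s /subexponential_normc_hyp2F1_coef[M fM]; exists M => n.
rewrite (le_trans _ (fM n))// (le_trans (normc_ge_Re _))//.
exact: ler_norm.
Qed.

Lemma subexponential_Im_hyp2F1_coef :
  subexponential (fun n => complex.Im (hyp2F1_coef n)).
Proof.
move=> s /subexponential_normc_hyp2F1_coef[M fM]; exists M => n.
rewrite (le_trans _ (fM n))// (le_trans (normc_ge_Im _))//.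
exact: ler_norm.
Qed.

(** Since [x] is real, real and imaginary parts pass to the coefficients, which reduces the complex
    series to two real power series. *)
Lemma hyp2F1E x : `|x| < 1 -> hyp2F1 a b c x =
  limn (pseries (fun n => complex.Re (hyp2F1_coef n)) x) +i*
  limn (pseries (fun n => complex.Im (hyp2F1_coef n)) x).
Proof.
move=> x1.
have ReE n : complex.Re (series (hyp2F1_term a b c x) n) =
    pseries (fun n => complex.Re (hyp2F1_coef n)) x n.
  rewrite /series/= (big_morph _ (@raddfD _ _ (@complex.Re R)) (raddf0 _)).
  by apply: eq_bigr => i _; rewrite hyp2F1_termE /=; case: hyp2F1_coef => p q; simpc.
have ImE n : complex.Im (series (hyp2F1_term a b c x) n) =
    pseries (fun n => complex.Im (hyp2F1_coef n)) x n.
  rewrite /series/= (big_morph _ (@raddfD _ _ (@complex.Im R)) (raddf0 _)).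
  by apply: eq_bigr => i _; rewrite hyp2F1_termE /=; case: hyp2F1_coef => p q; simpc.
apply: (@cvg_lim R[i]^o) => //; apply/cvg_complexP; rewrite (funext ReE) (funext ImE).
split; first exact: is_cvg_subexponential subexponential_Re_hyp2F1_coef x1.
exact: is_cvg_subexponential subexponential_Im_hyp2F1_coef x1.
Qed.

Lemma hyp2F1_0 : hyp2F1 a b c 0 = 1.
Proof.
(* The partial sums equal 1 from index 1 on; the one of index 0 is the empty sum. *)
apply: (@cvg_lim R[i]^o) => //; apply: cvg_near_cst; exists 1 => // -[//|n] _.
rewrite /series/= big_nat_recl// big1_seq ?addr0 => [|i _].
  rewrite hyp2F1_termE expr0 /hyp2F1_coef /pochhammer !big_ord0 fact0 !mulr1 invr1.
  exact: mulr1.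
by rewrite hyp2F1_termE exprS mul0r mulr0.
Qed.

Lemma continuous_normc_hyp2F1_sqr x : `|x| < 1 ->
  {for x, continuous (fun y => normc (hyp2F1 a b c y) ^+ 2)}.
Proof.
move=> x1.
pose P y := limn (pseries (fun n => complex.Re (hyp2F1_coef n)) y).
pose Q y := limn (pseries (fun n => complex.Im (hyp2F1_coef n)) y).
have PQE y : `|y| < 1 -> P y ^+ 2 + Q y ^+ 2 = normc (hyp2F1 a b c y) ^+ 2.
  by move=> y1; rewrite hyp2F1E//= sqr_sqrtr// addr_ge0 ?sqr_ge0.
have cP : {for x, continuous P}.
  exact: continuous_subexponential subexponential_Re_hyp2F1_coef x1.
have cQ : {for x, continuous Q}.
  exact: continuous_subexponential subexponential_Im_hyp2F1_coef x1.
have cPQ : {for x, continuous (fun y => P y ^+ 2 + Q y ^+ 2)}.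
  apply: (@cvgD _ R^o); first exact: (cvgM cP cP).
  exact: (cvgM cQ cQ).
(* [PQE] is available only on (-1, 1), but this is a neighbourhood of [x], which is enough for
   continuity at [x]. *)
clearbody P Q; move: cPQ; rewrite /prop_for /continuous_at (PQE x x1).
apply: cvg_trans; apply: near_eq_cvg; near=> y; apply: PQE.
near: y; apply: cvgr_norm_lt x1; exact: cvg_id.
Unshelve. all: by end_near. Qed.

End HypergeometricSeries.

(** * Integrals against a nonnegative weight *)

Section WeightedIntegral.
Context d (T : measurableType d) (R : realType) (mu : {measure set T -> \bar R}).
Variables (D : set T) (mD : measurable D).
Implicit Types (h w u v y : T -> R).

Lemma ge0_integrable_EFin h (r : R) : measurable_fun D h ->
  (forall x, D x -> 0 <= h x) -> (\int[mu]_(x in D) (h x)%:E = r%:E)%E ->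
  mu.-integrable D (EFin \o h).
Proof.
move=> mh h0 hr; apply/integrableP; split; first exact/measurable_EFinP.
rewrite (eq_integral (EFin \o h)) ?hr ?ltry// => x /set_mem Dx /=.
by rewrite ger0_norm// h0.
Qed.

(** Domination by the sum of the two integrable functions, as [|y u| <= u ^+ 2 + y ^+ 2]. *)
Lemma weighted_integrable_prod w u v y :
  measurable_fun D w -> measurable_fun D u -> measurable_fun D y ->
  (forall x, D x -> 0 <= w x) ->
  mu.-integrable D (EFin \o (fun x => (u x ^+ 2 + v x ^+ 2) * w x)) ->
  mu.-integrable D (EFin \o (fun x => y x ^+ 2 * w x)) ->
  mu.-integrable D (EFin \o (fun x => y x * w x * u x)).
Proof.
move=> mw mu_ my w0 iuv iy; apply: le_integrable (integrableD mD iuv iy) => //.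
  by apply/measurable_EFinP; do 2 apply: measurable_funM => //.
move=> x /w0 wx0 /=.
have -> : `|y x * w x * u x| = `|y x| * `|u x| * w x.
  by rewrite !normrM (ger0_norm wx0); ring.
rewrite lee_fin -mulrDl [leRHS]ger0_norm ?mulr_ge0// ?addr_ge0 ?sqr_ge0//.
rewrite ler_wpM2r//.
rewrite -(real_normK (num_real (u x))) -(real_normK (num_real (y x))).
have := sqr_ge0 (`|u x| - `|y x|); have := sqr_ge0 (v x).
have := sqr_ge0 `|u x|; have := sqr_ge0 `|y x|; nra.
Qed.

(** Expansion of the square, with [u] and [v] in the roles of the real and imaginary parts of [f].
    The left side is an extended integral, as its sign and its vanishing are exploited in that
    form. *)
Lemma integral_weighted_dist w u v y (t : R) :
  measurable_fun D w -> measurable_fun D u -> measurable_fun D y ->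
  (forall x, D x -> 0 <= w x) ->
  mu.-integrable D (EFin \o (fun x => (u x ^+ 2 + v x ^+ 2) * w x)) ->
  mu.-integrable D (EFin \o (fun x => y x ^+ 2 * w x)) ->
  (\int[mu]_(x in D) (((u x - t * y x) ^+ 2 + v x ^+ 2) * w x)%:E =
  (\int[mu]_(x in D) ((u x ^+ 2 + v x ^+ 2) * w x) -
   2 * t * \int[mu]_(x in D) (y x * w x * u x) +
   t ^+ 2 * \int[mu]_(x in D) (y x ^+ 2 * w x))%R%:E)%E.
Proof.
move=> mw mu_ my w0 iuv iy.
have iyu := weighted_integrable_prod mw mu_ my w0 iuv iy.
have iyu' : mu.-integrable D (EFin \o (fun x => 2 * t * (y x * w x * u x))).
  exact: (integrableZl mD (2 * t) iyu).
have iy' : mu.-integrable D (EFin \o (fun x => t ^+ 2 * (y x ^+ 2 * w x))).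
  exact: (integrableZl mD (t ^+ 2) iy).
rewrite -!RintegralZl// -RintegralB// -RintegralD//; last first.
  exact: (integrableB mD iuv iyu').
rewrite fineK; last first.
  apply: integrable_fin_num => //.
  exact: (integrableD mD (integrableB mD iuv iyu') iy').
by apply: eq_integral => x _; congr EFin; ring.
Qed.

End WeightedIntegral.

(** If [g x] were nonzero, continuity would make [g * w] nonzero on a ball around [x], of positive
    measure, whereas the zero integral confines such points to a null set [A]. *)
Lemma integral_continuous_eq0 (R : realType) (D : set R) (g w : R -> R) :
  open D -> {in D, continuous g} -> measurable_fun D w ->
  (forall x, D x -> 0 <= g x) -> (forall x, D x -> 0 < w x) ->
  (\int[lebesgue_measure]_(x in D) (g x * w x)%:E = 0)%E ->
  forall x, D x -> g x = 0.
Proof.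
move=> oD cg mw g0 w0 gw0 x Dx; apply/eqP/negPn/negP => gx0.
have mD : measurable D by exact: open_measurable.
have mg : measurable_fun D g by exact: open_continuous_measurable_fun.
have : (\int[lebesgue_measure]_(x in D) `|(g x * w x)%:E| = 0)%E.
  rewrite -[RHS]gw0; apply: eq_integral => y /set_mem Dy.
  by rewrite gee0_abs// lee_fin mulr_ge0// ?g0// ltW// w0.
have mgw : measurable_fun D (fun x => (g x * w x)%:E).
  by apply/measurable_EFinP; exact: measurable_funM.
move/(ae_eq_integral_abs lebesgue_measure mD mgw) => -[A [mA A0 subA]].
have : \forall y \near x, D y /\ g y != 0.
  near=> y; split; near: y; first exact: open_nbhs_nbhs.
  exact: (cvgr_neq0 _ (cg x (mem_set Dx)) gx0).
move=> /nbhs_ballP[e /= e0 eD].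
have : (lebesgue_measure (ball x e) <= lebesgue_measure A)%E.
  apply: le_measure; rewrite ?inE//; first exact: measurable_ball.
  move=> y /eD[Dy gy0]; apply: subA => /(_ Dy)/= [/eqP].
  by rewrite mulf_eq0 (negbTE gy0) gt_eqF// w0.
rewrite A0 (lebesgue_measure_ball _ (ltW e0)) lee_fin leNgt => /negP; apply.
by rewrite mulrn_wgt0.
Unshelve. all: by end_near. Qed.

(** * The weight and the density as real functions *)

Lemma normc_cpow (R : realType) (x : R) (s : R[i]) :
  normc (cpow x s) = x `^ complex.Re s.
Proof.
rewrite /cpow normcM /= expr0n addr0 cos2Dsin2 sqrtr1 mulr1 sqrtr_sqr.
by rewrite ger0_norm// powR_ge0.
Qed.

Section Density.
Variables (R : realType) (a b c : R[i]).
Local Notation Y := (fun x : R => normc (hyp2F1 a b c x) ^+ 2).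
Local Notation W := (fun x : R => normc (omega a b c x)).

Lemma measurable_normc_omega D : measurable_fun D W.
Proof.
apply: measurable_funTS; rewrite (_ : W = (fun x => x `^ complex.Re (c - 1) *
    (1 - x) `^ complex.Re (a + b - c))); last first.
  by apply/funext => x; rewrite /omega normcM !normc_cpow.
apply: measurable_funM; first exact: measurable_powR.
apply: (measurableT_comp (measurable_powR _)) => //.
exact: measurable_funB.
Qed.

Lemma normr_hyp2F1_sqr x : `|hyp2F1 a b c x| ^+ 2 = (Y x)%:C.
Proof. by rewrite norm_normc rmorphXn. Qed.

(** Positivity in [R[i]] includes being real, so the weight coincides with its modulus. *)
Lemma gt0_omegaE x : 0 < omega a b c x -> omega a b c x = (W x)%:C.
Proof. by move=> w0; rewrite -norm_normc gtr0_norm. Qed.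

Lemma rhoE x : 0 < omega a b c x -> rho a b c x = (Y x * W x)%:C.
Proof. by move=> w0; rewrite /rho normr_hyp2F1_sqr {1}gt0_omegaE// [RHS]rmorphM. Qed.

Lemma rho_sqr_div_omegaE x : 0 < omega a b c x ->
  rho a b c x ^+ 2 / omega a b c x = (Y x ^+ 2 * W x)%:C.
Proof.
move=> w0; rewrite /rho exprMn -mulrA expr2 mulfK ?gt_eqF//.
by rewrite normr_hyp2F1_sqr {1}gt0_omegaE// [RHS]rmorphM [in RHS]rmorphXn.
Qed.

End Density.

(** * The bound and its equality case *)

Theorem proposition3p3 (R : realType) (a b c : R[i])
    (c_generic : forall n : nat, c != - n%:R)
    (omega_gt0 : forall x : R, 0 < x < 1 -> 0 < omega a b c x)
    (f : R -> R[i])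
    (f_cont : {in `]0%R, 1%R[, continuous (f : R -> R[i]^o)})
    (f_norm : inner (omega a b c) f f = 1)
    (lambda1 : R)
    (lambda1E : lambda1%:C = cint01 (fun x => rho a b c x * f x)) :
  let bound : \bar R :=
    ((\int[lebesgue_measure]_(x in `]0%R, 1%R[)
        (complex.Re (rho a b c x ^+ 2 / omega a b c x))%:E) `^ 2^-1)%E in
  (lambda1%:E <= bound)%E /\
  (lambda1%:E = bound <->
   exists C : R, 0 < C /\
     forall x : R, 0 < x < 1 -> f x = C%:C * `|hyp2F1 a b c x| ^+ 2).
Proof.
set D := [set` `]0%R, 1%R[]; move=> bound.
pose y (x : R) : R := normc (hyp2F1 a b c x) ^+ 2.
pose w (x : R) : R := normc (omega a b c x).
pose u (x : R) : R := complex.Re (f x); pose v (x : R) : R := complex.Im (f x).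
have D01 (x : R) : D x -> 0 < x < 1 by rewrite /D/= in_itv.
have mD : measurable D by exact: measurable_itv.
have oD : open D by exact: interval_open.
have w0 (x : R) : D x -> 0 < w x.
  by move=> /D01/omega_gt0 wx; rewrite -ltcR -gt0_omegaE.
have w0' (x : R) : D x -> 0 <= w x by move/w0/ltW.
have mw : measurable_fun D w by exact: measurable_normc_omega.
have cyN (x : R) : `|x| < 1 -> {for x, continuous y}.
  exact: continuous_normc_hyp2F1_sqr.
have cy : {in D, continuous y}.
  by move=> x /set_mem/D01/andP[x0 x1]; apply: cyN; rewrite ger0_norm// ltW.
have cu : {in D, continuous u}.
  by move=> x /set_mem xD; have /cvg_complexP[] := f_cont x xD.
have cv : {in D, continuous v}.
  by move=> x /set_mem xD; have /cvg_complexP[] := f_cont x xD.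
have [my mu mv] : [/\ measurable_fun D y, measurable_fun D u & measurable_fun D v].
  by split; exact: open_continuous_measurable_fun.
have boundE : bound = ((\int[lebesgue_measure]_(x in D) (y x ^+ 2 * w x)%:E) `^ 2^-1)%E.
  congr (_ `^ _)%E; apply: eq_integral => x /set_mem/D01/omega_gt0 wx.
  by rewrite rho_sqr_div_omegaE.
(* The density is real on (0, 1), so the real part of the integral involves only the real part of
   [f]. *)
have lambdaE : lambda1 = \int[lebesgue_measure]_(x in D) (y x * w x * u x).
  have -> : lambda1 = complex.Re lambda1%:C by [].
  rewrite lambda1E /=; apply: eq_Rintegral => x /set_mem/D01/omega_gt0 wx.
  by rewrite rhoE// /u /y /w; case: (f x) => p q; simpc.
have normE : (\int[lebesgue_measure]_(x in D) ((u x ^+ 2 + v x ^+ 2) * w x)%:E = 1%:E)%E.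
  have : \int[lebesgue_measure]_(x in D) ((u x ^+ 2 + v x ^+ 2) * w x) = 1.
    have -> : 1 = complex.Re (1 : R[i]) by [].
    rewrite -f_norm /=; apply: eq_Rintegral => x /set_mem/D01/omega_gt0 wx.
    rewrite gt0_omegaE// /u /v /w; case: (f x) => p q; simpc.
    by rewrite -!expr2.
  (* [fine] sends both infinities to 0, so the value 1 forces the extended integral to be finite. *)
  rewrite /Rintegral.
  by case: (\int[lebesgue_measure]_(x in D) _)%E => [r /= ->||] //= /esym/eqP;
    rewrite oner_eq0.
have muv : measurable_fun D (fun x => (u x ^+ 2 + v x ^+ 2) * w x).
  by apply: measurable_funM => //; apply: measurable_funD; exact: measurable_funX.
have iuv := @ge0_integrable_EFin _ _ R lebesgue_measure D _ _ muv
  (fun x Dx => mulr_ge0 (addr_ge0 (sqr_ge0 _) (sqr_ge0 _)) (w0' x Dx)) normE.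
have myy : measurable_fun D (fun x => y x ^+ 2 * w x).
  by apply: measurable_funM => //; exact: measurable_funX.
have yw0 x : D x -> 0 <= y x ^+ 2 * w x.
  by move=> Dx; rewrite mulr_ge0 ?sqr_ge0 ?w0'.
have fE (C : R) : (forall x, 0 < x < 1 -> f x = C%:C * `|hyp2F1 a b c x| ^+ 2) ->
    forall x, D x -> u x = C * y x /\ v x = 0.
  move=> fC x /D01/fC; rewrite normr_hyp2F1_sqr -/(y x) -rmorphM /u /v => -> //.
(* The normalization for [f = C y]: it excludes an infinite integral, and determines [C ^+ 2] when
   the integral is finite. *)
have normCE (C : R) :
    (forall x, 0 < x < 1 -> f x = C%:C * `|hyp2F1 a b c x| ^+ 2) ->
    (1 = (C ^+ 2)%:E * \int[lebesgue_measure]_(x in D) (y x ^+ 2 * w x)%:E)%E.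
  move=> /fE fC; rewrite -ge0_integralZl//=; last 2 first.
  - by apply/measurable_EFinP; exact: myy.
  - by rewrite lee_fin sqr_ge0.
  rewrite -normE; apply: eq_integral => x /set_mem /fC[-> ->].
  by rewrite -EFinM; congr EFin; ring.
have [I IE] : exists I, (\int[lebesgue_measure]_(x in D) (y x ^+ 2 * w x)%:E = I)%E.
  by eexists.
have I0 : (0 <= I)%E.
  by rewrite -IE; apply: integral_ge0 => x Dx; rewrite lee_fin yw0.
rewrite IE in boundE normCE.
case: I I0 IE boundE normCE => [B||//] B0 yE boundE normCE; last first.
  rewrite boundE poweRyr ?invr_eq0 ?pnatr_eq0//; split; first exact: leey.
  split=> // -[C [C0 /normCE]]; rewrite mulry gtr0_sg ?exprn_gt0//.
  by rewrite mul1e.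
rewrite lee_fin in B0.
(* A zero integral makes [y] vanish on (0, 1). The point 0, where [y] is 1, lies outside this
   interval, but continuity there makes [y] nonzero at small positive points. *)
have B_gt0 : 0 < B.
  rewrite lt_neqAle B0 andbT; apply/eqP => B0'.
  have y0 x : D x -> y x = 0.
    move=> Dx; apply/eqP; rewrite -sqrf_eq0; apply/eqP; move: x Dx.
    apply: (integral_continuous_eq0 oD _ mw _ w0) => [x xD|x Dx|].
    - by apply: cvgM; exact: cy.
    - exact: sqr_ge0.
    - by rewrite yE -B0'.
  have : y 0 != 0 by rewrite /y hyp2F1_0 normc1 expr1n oner_eq0.
  have cy0 : y @ 0 --> y 0 by apply: cyN; rewrite normr0.
  move=> /(cvgr_neq0 _ cy0) /nbhs_ballP[e /= e0].
  (* This point lies both in the ball of radius [e] around 0 and in (0, 1). *)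
  pose x := Num.min e 1 / 2.
  have x0 : 0 < x by rewrite divr_gt0// lt_min e0 ltr01.
  have xm : x < Num.min e 1 by rewrite ltr_pdivrMr// ltr_pMr// ?ltr1n// lt_min e0 ltr01.
  move: xm; rewrite lt_min => /andP[xe x1].
  move=> /(_ x); rewrite /ball/= sub0r normrN gtr0_norm// => /(_ xe).
  by rewrite y0 ?eqxx// /D/= in_itv/= x0.
have iy := @ge0_integrable_EFin _ _ R lebesgue_measure D _ _ myy yw0 yE.
pose s := Num.sqrt B.
have s0 : 0 < s by rewrite sqrtr_gt0.
have sB : s ^+ 2 = B by rewrite sqr_sqrtr.
have boundsE : bound = s%:E by rewrite boundE poweR_EFin powR12_sqrt.
have distE : (\int[lebesgue_measure]_(x in D) (((u x - s^-1 * y x) ^+ 2 + v x ^+ 2) * w x)%:E =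
    (2 * (1 - lambda1 / s))%:E)%E.
  rewrite integral_weighted_dist// -lambdaE /Rintegral normE yE /=; congr EFin.
  by rewrite -sB; field; rewrite gt_eqF.
rewrite boundsE lee_fin; split.
  have : (0 <= (2 * (1 - lambda1 / s))%:E)%E.
    rewrite -distE; apply: integral_ge0 => x Dx.
    by rewrite lee_fin mulr_ge0 ?w0'// addr_ge0 ?sqr_ge0.
  by rewrite lee_fin pmulr_rge0// subr_ge0 ler_pdivrMr// mul1r.
split=> [[ls]|[C [C0 fC]]].
  exists s^-1; rewrite invr_gt0; split=> // x x01.
  have Dx : D x by rewrite /D/= in_itv.
  (* Both squares then vanish, so [f x] is real and equal to [s^-1 * y x]. *)
  have : (u x - s^-1 * y x) ^+ 2 + v x ^+ 2 = 0.
    move: x Dx {x01}; apply: (integral_continuous_eq0 oD _ mw _ w0) => [x xD|x Dx|].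
    - have cuy : {for x, continuous (fun x => u x - s^-1 * y x)}.
        apply: (@cvgB _ R^o); first exact: cu.
        by apply: cvgM; [exact: cvg_cst|exact: cy].
      by apply: (@cvgD _ R^o); [exact: (cvgM cuy cuy)|apply: cvgM; exact: cv].
    - by rewrite addr_ge0 ?sqr_ge0.
    - by rewrite distE ls divff ?gt_eqF// subrr mulr0.
  move/eqP; rewrite paddr_eq0 ?sqr_ge0// !sqrf_eq0 subr_eq0 => /andP[/eqP ux /eqP vx].
  rewrite normr_hyp2F1_sqr -/(y x) -rmorphM/= -ux.
  by move: vx; rewrite /u /v; case: (f x) => p q /= ->.
(* The normalization reads [(C * s) ^+ 2 = 1], and positivity of [C] selects [C * s = 1]; the
   opposite root would give [lambda1 = - s]. *)
have /esym/eqP := normCE C fC; rewrite -EFinM eqe -sB -exprMn.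
rewrite sqrp_eq1 ?mulr_ge0// ?ltW// => /eqP Cs.
congr EFin; rewrite lambdaE.
have -> : s = C * B by rewrite -sB expr2 mulrA Cs mul1r.
rewrite -[B]/(fine B%:E) -yE -RintegralZl//.
by apply: eq_Rintegral => x /set_mem/(fE _ fC)[-> _]; ring.
Qed.
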